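(* Let $I=[a,b]$ be a compact interval, let $(X,d)$ be a metric space, let $g:I\to\mathbb R$ be left-continuous and nondecreasing, let $\alpha>1$, and let $F:I\to\mathcal K(X)$ be $g$-Hölder of exponent $\alpha$. Set $L=[F]_{\alpha,g}<\infty$. Then, for every $a\le s<t\le b$, $$V_H(F;[s,t])\le L\sum_{\tau\in[s,t)}[\Delta^+g(\tau)]^\alpha.$$
   Context: $\mathcal K(X)$ is the family of all nonempty compact subsets of $X$ with Hausdorff distance $d_H$. $F$ is $g$-Hölder of exponent $\alpha$ if there is $L\ge0$ with $d_H(F(s),F(t))\le L|g(t)-g(s)|^\alpha$ for all $s,t\in I$; $[F]_{\alpha,g}$ is the minimum such $L$. $V_H(F;[s,t])=\sup_P\sum_{i=1}^n d_H(F(t_{i-1}),F(t_i))$ over all finite partitions $P:s=t_0<\cdots<t_n=t$. For $\tau\in[a,b)$, $\Delta^+g(\tau)=g(\tau+)-g(\tau)$ with $g(\tau+)=\lim_{r\downarrow\tau}g(r)$; the sum has at most countably many nonzero terms. *)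

(* Defs.v *)
From mathcomp Require Import all_boot all_order all_algebra.
From mathcomp Require Import all_classical all_reals all_analysis.

Set Implicit Arguments.
Unset Strict Implicit.
Unset Printing Implicit Defensive.

Import Order.TTheory GRing.Theory Num.Theory.
Import numFieldNormedType.Exports.

Local Open Scope classical_set_scope.
Local Open Scope ring_scope.

Section Hyperspace.
Context {R : realType} {X : metricType R}.
Implicit Types (x : X) (A B : set X).

Definition nonempty_compacts : set (set X) :=
  [set A | A !=set0 /\ compact A].

Definition dist_to_set x A : R := inf [set mdist x y | y in A].

(* [inf] and [sup] are real-valued, with value 0 on sets that are empty or
   unbounded in the relevant direction; neither case arises when A and B are
   nonempty and compact. *)
Definition hausdorff_dist A B : R :=
  Num.max (sup [set dist_to_set x B | x in A])
          (sup [set dist_to_set y A | y in B]).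

End Hyperspace.

Section SetValuedFunctions.
Context {R : realType} {X : metricType R}.
Implicit Types (a b s t alpha : R) (g : R -> R) (F : R -> set X) (p : seq R).

(* A function on [a, b] is represented by a total function on R of which only
   the restriction to [a, b] is used. *)

Definition holder_consts a b g alpha F : set R :=
  [set L | 0 <= L /\
    {in `[a, b] &, forall s t,
      hausdorff_dist (F s) (F t) <= L * `|g t - g s| `^ alpha}].

Definition is_holder a b g alpha F : Prop := holder_consts a b g alpha F !=set0.

(* The infimum is a minimum by [holder_seminorm_min] below. *)
Definition holder_seminorm a b g alpha F : R :=
  inf (holder_consts a b g alpha F).

(* As in [itv_partition], the partition s = t_0 < ... < t_n = t is the list
   p = [t_1; ...; t_n], its first point s being kept apart. *)
Definition hausdorff_variation s t F p : R :=
  let G := F \o nth t (s :: p) in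
  \sum_(0 <= i < size p) hausdorff_dist (G i) (G i.+1).

Definition total_hausdorff_variation s t F : \bar R :=
  ereal_sup [set (hausdorff_variation s t F p)%:E | p in itv_partition s t].

Definition right_jump g (tau : R) : R := lim (g x @[x --> tau^'+]) - g tau.

Lemma holder_seminorm_min a b g alpha F : is_holder a b g alpha F ->
  holder_consts a b g alpha F (holder_seminorm a b g alpha F) /\
  lbound (holder_consts a b g alpha F) (holder_seminorm a b g alpha F).
Proof.
move=> hF; rewrite /holder_seminorm.
set C := holder_consts a b g alpha F in hF *.
have C0 : lbound C 0 by move=> L [].
have hlb : has_lbound C by exists 0.
split; last by move=> L CL; exact: ge_inf.
split=> [|s t sI tI]; first exact: lb_le_inf.
have := powR_ge0 `|g t - g s| alpha; rewrite le_eqVlt => /orP[/eqP w0|w0].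
  case: hF => L [_ /(_ s t sI tI)].
  by rewrite -w0 !mulr0.
rewrite -ler_pdivrMr//; apply: lb_le_inf => // L [_ /(_ s t sI tI)].
by rewrite ler_pdivrMr.
Qed.

End SetValuedFunctions.

Arguments nonempty_compacts {R} X.

(* Main.v *)
Require Import Defs.
From mathcomp Require Import all_boot all_order all_algebra.
From mathcomp Require Import all_classical all_reals all_analysis.
From mathcomp Require Import ring lra.

Import Order.TTheory GRing.Theory Num.Theory.
Import numFieldNormedType.Exports.

Local Open Scope classical_set_scope.
Local Open Scope ring_scope.

(* Put S u = \sum_(tau in [s, u)) (Delta^+ g tau)^alpha. For every e > 0 and
   L = [F]_(alpha, g), the function Phi u = L ((1 + e) S u + e g u) dominates
   the increments of F locally: to the right of x, (g y - g x)^alpha is at most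
   (1 + e) (Delta^+ g x)^alpha + e (g y - g x), and the jump at x is counted by
   S y - S x; to the left of x, g is continuous, so that
   (g x - g y)^alpha <= e (g x - g y) as alpha > 1. By the triangle inequality
   and continuous induction the domination is global on [s, t]; sums over
   partitions then telescope, and e tends to 0. *)

Section HausdorffDistance.
Context {R : realType} {X : metricType R}.
Implicit Types (x y z : X) (A B C : set X).

(** Near each [y], every bound [M] beyond [mdist x y + 1] works; compactness makes one such [M]
    serve all of [A]. This boundedness keeps [sup] in [hausdorff_dist] away from its default
    value. *)
Lemma compact_mdist_bounded x A : compact A ->
  exists M : R, forall y, A y -> mdist x y <= M.
Proof.
move=> /compact_near_coveringP Anc.
have /Anc : forall y, A y ->
    \forall z \near y & M \near +oo, mdist x z <= M.
  move=> y _; exists (ball y 1, [set M | mdist x y + 1 < M]).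
    by split; [exact: nbhsx_ballx|apply: nbhs_pinfty_gt; rewrite num_real].
  move=> [z M]; rewrite /= ballEmdist/= => -[yz /ltW]; apply: le_trans.
  by rewrite (le_trans (metric_triangle x y z))// lerD2l ltW.
by move=> /filter_ex[M AM]; exists M.
Qed.

Lemma dist_to_set_le x y A : A y -> dist_to_set x A <= mdist x y.
Proof.
move=> Ay; apply: ge_inf; last by exists y.
by exists 0 => _ [z _ <-]; exact: mdist_ge0.
Qed.

Lemma dist_to_set_triangle x y A : A !=set0 ->
  dist_to_set x A <= mdist x y + dist_to_set y A.
Proof.
move=> [z Az]; rewrite -lerBlDl; apply: lb_le_inf.
  by exists (mdist y z), z.
move=> _ [w Aw <-]; rewrite lerBlDl.
by rewrite (le_trans (dist_to_set_le x _ _ Aw))// metric_triangle.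
Qed.

Lemma hausdorff_distC A B : hausdorff_dist A B = hausdorff_dist B A.
Proof. by rewrite /hausdorff_dist maxC. Qed.

Lemma dist_to_set_hausdorff x A B : compact A -> B !=set0 -> A x ->
  dist_to_set x B <= hausdorff_dist A B.
Proof.
move=> cA [y By] Ax; rewrite /hausdorff_dist le_max; apply/orP; left.
apply: ub_le_sup; last by exists x.
have [M AM] := compact_mdist_bounded y _ cA.
exists M => _ [z Az <-]; rewrite (le_trans (dist_to_set_le z _ _ By))//.
by rewrite metric_sym AM.
Qed.

(** The two one-sided suprema are bounded separately, the second by symmetry. For [x] in [A], the
    distance from [x] to [C] is at most [mdist x y + hausdorff_dist B C] for every [y] in [B]; then
    the infimum over [y] is taken. *)
Lemma hausdorff_dist_triangle A B C :
  nonempty_compacts X A -> nonempty_compacts X B -> nonempty_compacts X C ->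
  hausdorff_dist A C <= hausdorff_dist A B + hausdorff_dist B C.
Proof.
have sup_le A' B' C' : nonempty_compacts X A' -> nonempty_compacts X B' ->
    nonempty_compacts X C' ->
    sup [set dist_to_set x C' | x in A'] <=
      hausdorff_dist A' B' + hausdorff_dist B' C'.
  move=> [[x0 Ax0] cA] [[y0 By0] cB] [C0 cC]; apply: ge_sup.
    by exists (dist_to_set x0 C'), x0.
  move=> _ [x Ax <-].
  have B0 : B' !=set0 by exists y0.
  apply: le_trans (lerD (dist_to_set_hausdorff _ _ _ cA B0 Ax) (lexx _)).
  rewrite -lerBlDr; apply: lb_le_inf; first by exists (mdist x y0), y0.
  move=> _ [y By <-]; rewrite lerBlDr.
  rewrite (le_trans (dist_to_set_triangle x y _ C0))// lerD2l.
  exact: dist_to_set_hausdorff.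
move=> hA hB hC; rewrite {1}/hausdorff_dist ge_max sup_le//=.
by rewrite addrC (hausdorff_distC A) (hausdorff_distC B) sup_le.
Qed.

End HausdorffDistance.

(* Continuous induction: the points reached from [u] with the claimed bound
   form a set that contains its supremum (by the estimate on the left) and
   whose supremum cannot be less than [v] (by the estimate on the right). *)
Lemma increment_bound_local_to_global {R : realType} (d : R -> R -> R)
    (Phi : R -> R) (a b : R) :
  {in `[a, b], forall x, d x x <= 0} ->
  {in `[a, b] & &, forall x y z, d x z <= d x y + d y z} ->
  {in `[a, b[, forall x, \forall y \near x^'+, d x y <= Phi y - Phi x} ->
  {in `]a, b], forall x, \forall y \near x^'-, d y x <= Phi x - Phi y} ->
  {in `[a, b] &, forall u v, u <= v -> d u v <= Phi v - Phi u}.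
Proof.
move=> dxx tri dr dl u v; rewrite !in_itv/= => /andP[au ub] /andP[av vb] uv.
pose E := [set c | [/\ u <= c, c <= v & d u c <= Phi c - Phi u]].
have Eu : E u by split=> //; rewrite subrr dxx// in_itv/= au.
have ubE : ubound E v by move=> c [].
have supE : has_sup E by split; [exists u|exists v].
have Ein c : E c -> c \in `[a, b].
  by move=> [uc cv _]; rewrite in_itv/= (le_trans au uc) (le_trans cv vb).
set z := sup E.
have uz : u <= z by apply: ub_le_sup => //; exists v.
have zv : z <= v by apply: ge_sup => //; exists u.
(* A local bound from [c] to [w] is glued to the one from [u] to [c] by the triangle inequality.
   This serves twice: to reach [z] from a point just below it, and to go beyond [z]. *)
have step c w : E c -> c <= w -> w <= v -> d c w <= Phi w - Phi c -> E w.
  move=> Ec cw wv dcw; split=> //; first by case: Ec => /le_trans ->.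
  have win : w \in `[a, b].
    move: (Ein _ Ec); rewrite !in_itv/= => /andP[ac _].
    by rewrite (le_trans ac cw) (le_trans wv vb).
  case: (Ec) => _ _ duc.
  have := tri u c w; rewrite win (Ein c)// (Ein u)// => /(_ isT isT isT); lra.
have Ez : E z.
  have [<-//|uz'] := eqVneq u z.
  have ltuz : u < z by rewrite lt_neqAle uz' uz.
  have zin' : z \in `]a, b] by rewrite in_itv/= (le_lt_trans au) ?(le_trans zv).
  have [e /= e0 He] := dl _ zin'.
  have [c Ec zec] := sup_adherent e0 supE.
  have cz : c <= z by apply: ub_le_sup => //; exists v.
  have [<-//|cz'] := eqVneq c z.
  have ltcz : c < z by rewrite lt_neqAle cz' cz.
  apply: (step c) => //; apply: He => //=.
  by rewrite ger0_norm ?subr_ge0//; move: zec; rewrite -/z; lra.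
have [zvE|zv'] := eqVneq z v; first by case: Ez; rewrite zvE.
have ltzv : z < v by rewrite lt_neqAle zv' zv.
have zin' : z \in `[a, b[.
  by rewrite in_itv/= (le_trans au uz) (lt_le_trans ltzv vb).
near z^'+ => w.
have zw : z < w by near: w; exact: nbhs_right_gt.
suff : E w by move=> /(ub_le_sup (ex_intro _ v ubE)); rewrite -/z leNgt zw.
apply: (step z) => //; first exact: ltW.
by near: w; exact: dr.
Unshelve. all: by end_near. Qed.

(* The multiplicative slack pays for positive [J], the linear term in [h] for
   [J = 0], where [h `^ alpha] is [o(h)] because [1 < alpha]. *)
Lemma powR_le_near {R : realType} (alpha e J : R) :
  1 < alpha -> 0 < e -> 0 <= J ->
  exists2 delta, 0 < delta & forall h, 0 <= h -> h < J + delta ->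
    h `^ alpha <= (1 + e) * J `^ alpha + e * h.
Proof.
move=> a1 e0; have a0 : 0 < alpha by lra.
rewrite le_eqVlt => /predU1P[<-|J0].
  (* Below this threshold [h ^ (alpha - 1) <= e], and [h ^ alpha] is [h] times that power. *)
  exists (e `^ (alpha - 1)^-1); first exact: powR_gt0.
  move=> h h0; rewrite add0r => hd.
  rewrite powR0 ?gt_eqF// mulr0 add0r -mulr_powRB1// mulrC ler_wpM2r//.
  have a10 : 0 < alpha - 1 by lra.
  have -> : e = (e `^ (alpha - 1)^-1) `^ (alpha - 1).
    by rewrite -powRrM mulVf ?gt_eqF// powRr1// ltW.
  by apply: (ge0_ler_powR (ltW a10)); rewrite ?nnegrE ?powR_ge0// ltW.
(* The dilation [k > 1] is chosen so that [(k * J) ^ alpha] equals [(1 + e) * J ^ alpha]; the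
   witness [(k - 1) * J] turns [h < J + delta] into [h < k * J]. *)
pose k := (1 + e) `^ alpha^-1.
have ka : k `^ alpha = 1 + e.
  by rewrite -powRrM mulVf ?gt_eqF// powRr1//; lra.
have k1 : 1 < k.
  rewrite ltNge; apply/negP => k1.
  have : k `^ alpha <= 1 `^ alpha.
    by apply: (ge0_ler_powR (ltW a0)) => //; rewrite nnegrE ?powR_ge0 ?ler01.
  by rewrite ka powR1; lra.
exists ((k - 1) * J); first by rewrite mulr_gt0// subr_gt0.
move=> h h0 hk; rewrite -[leLHS]addr0 lerD//; last by rewrite mulr_ge0// ltW.
rewrite -ka -powRM ?powR_ge0 ?(ltW J0)//.
have kJ0 : 0 <= k * J by rewrite mulr_ge0 ?powR_ge0 ?(ltW J0).
have hkJ : h <= k * J by lra.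
by apply: (ge0_ler_powR (ltW a0)); rewrite ?nnegrE.
Qed.

(** By monotonicity the right limit exists and is the infimum of [g] over []tau, b[], with [g tau]
    as a lower bound. Hence the [lim] in [right_jump] is a genuine limit and not a default value. *)
Lemma right_jump_cvg {R : realType} (g : R -> R) (a b tau : R) :
  {in `[a, b] &, forall x y, x <= y -> g x <= g y} -> tau \in `[a, b[ ->
  g x @[x --> tau^'+] --> g tau + right_jump g tau /\ 0 <= right_jump g tau.
Proof.
move=> g_nondecr; rewrite in_itv/= => /andP[atau taub].
have lbg : lbound (g @` `]tau, b[) (g tau).
  move=> _ [x /= + <-]; rewrite in_itv/= => /andP[tx xb].
  by apply: g_nondecr; rewrite ?in_itv/= ?atau ?(ltW taub) ?(ltW xb)
    ?(le_trans atau (ltW tx)) ?(ltW tx).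
have cvg_inf : g x @[x --> tau^'+] --> inf (g @` `]tau, b[).
  have := @nondecreasing_at_right_cvgr R g tau (BLeft b); apply.
  - by rewrite bnd_simp.
  - move=> x y; rewrite !in_itv/= => /andP[tx xb] /andP[ty yb] xy.
    by apply: g_nondecr; rewrite ?in_itv/= ?(ltW xb) ?(ltW yb) ?andbT//;
      apply/ltW/(le_lt_trans atau).
  - by exists (g tau).
rewrite /right_jump (cvg_lim (@Rhausdorff R) cvg_inf) subrKC; split=> //.
rewrite subr_ge0; apply: lb_le_inf => //.
exists (g ((tau + b) / 2)), ((tau + b) / 2) => //=.
by rewrite in_itv/= midf_lt//= midf_lt.
Qed.

Section NonnegativeSums.
Context {R : realType}.
Local Open Scope ereal_scope.

Lemma le_esum_mem {T : choiceType} (f : T -> \bar R) (A : set T) x :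
  A x -> 0 <= f x -> f x <= \esum_(i in A) f i.
Proof.
move=> Ax fx0; apply: esum_ge; exists [set x]; last by rewrite fsbig_set1.
by split=> [|_ ->//]; exact: finite_set1.
Qed.

Lemma esum_itvco_split (f : R -> \bar R) (s u v : R) :
  (forall x, 0 <= f x) -> (s <= u)%R -> (u <= v)%R ->
  \esum_(i in `[s, v[) f i =
    \esum_(i in `[s, u[) f i + \esum_(i in `[u, v[) f i.
Proof.
move=> f0 su uv; rewrite (esumID `[s, u[%classic); last by move=> i _.
congr (_ + _); congr (esum _ _); apply/seteqP; split=> x /=; rewrite !in_itv/=.
- by case.
- by move=> /andP[sx xu]; rewrite sx xu (lt_le_trans xu).
- by move=> [/andP[sx xv]] /negP; rewrite sx xv/= -leNgt => ->.
- move=> /andP[ux xv]; rewrite (le_trans su ux) xv; split=> //.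
  by apply/negP; rewrite -leNgt.
Qed.

End NonnegativeSums.

Lemma hausdorff_variation_le {R : realType} {X : metricType R}
    (F : R -> set X) (Phi : R -> R) (s t : R) (p : seq R) :
  {in `[s, t] &, forall u v, u <= v ->
    hausdorff_dist (F u) (F v) <= Phi v - Phi u} ->
  itv_partition s t p -> hausdorff_variation s t F p <= Phi t - Phi s.
Proof.
move=> FPhi sp; have [_ /eqP pt] := sp.
have -> : Phi t - Phi s =
    \sum_(0 <= i < size p) (Phi (nth t (s :: p) i.+1) - Phi (nth t (s :: p) i)).
  rewrite (telescope_sumr (fun i => Phi (nth t (s :: p) i)))//=.
  by rewrite -[size p]/(size (s :: p)).-1 nth_last/= pt.
have nth_st k : (k < (size p).+1)%N -> nth t (s :: p) k \in `[s, t].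
  move=> kp; rewrite in_itv; apply/andP.
  by split; [exact: itv_partition_nth_ge|exact: itv_partition_nth_le].
rewrite /hausdorff_variation big_nat [leRHS]big_nat.
apply: ler_sum => i /andP[_ ip].
apply: FPhi; [exact/nth_st/ltnW|exact: nth_st|].
(* Taken at [id], this lemma orders consecutive partition points. *)
by have := @nondecreasing_fun_itv_partition _ _ s t id p; apply.
Qed.

Theorem theorem8p2 (R : realType) (X : metricType R) (a b : R)
    (g : R -> R) (alpha : R) (F : R -> set X)
    (hab : a <= b)
    (g_left_cont : {in `]a, b], forall x, g y @[y --> x^'-] --> g x})
    (g_nondecr : {in `[a, b] &, forall x y, x <= y -> g x <= g y})
    (halpha : 1 < alpha)
    (F_compact : {in `[a, b], forall x, nonempty_compacts X (F x)})
    (F_holder : is_holder a b g alpha F)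
    (s t : R) (has : a <= s) (hst : s < t) (htb : t <= b) :
  (total_hausdorff_variation s t F <=
    (holder_seminorm a b g alpha F)%:E *
      \esum_(tau in `[s, t[) ((right_jump g tau) `^ alpha)%:E)%E.
Proof.
have [[]] := holder_seminorm_min F_holder.
set L := holder_seminorm a b g alpha F => L0 FL _.
set J := fun tau => right_jump g tau `^ alpha.
have J0 x : 0 <= J x by exact: powR_ge0.
have subab x : x \in `[s, t] -> x \in `[a, b].
  by rewrite !in_itv/= => /andP[sx xt]; rewrite (le_trans has) ?(le_trans xt).
have st_left x : x \in `[s, t[ -> x \in `[s, t].
  by rewrite !in_itv/= => /andP[-> /ltW].
have st_right x : x \in `]s, t] -> x \in `[s, t].
  by rewrite !in_itv/= => /andP[/ltW -> ->].
pose S u := (\esum_(tau in `[s, u[) (J tau)%:E)%E.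
have S0 u : (0 <= S u)%E by apply: esum_ge0 => i _; rewrite lee_fin.
rewrite -/(S t); apply: ge_ereal_sup => _ [p sp <-].
(* If [L = 0], all increments of [F] vanish and the right-hand side is 0 even for an infinite sum.
   If [L > 0], an infinite sum makes the bound trivial, so [S t] may be taken finite. *)
move: L0; rewrite [0 <= L]le_eqVlt => /predU1P[L0|L0].
  rewrite -L0 mul0e lee_fin.
  have := @hausdorff_variation_le _ _ F (cst 0) s t p.
  rewrite subrr; apply=> //.
  move=> u v /subab uab /subab vab _.
  by rewrite (le_trans (FL _ _ uab vab))// -L0 mul0r.
have [->|Soo] := eqVneq (S t) +oo%E; first by rewrite gt0_muley ?leey.
have S_split u v : s <= u -> u <= v ->
    S v = (S u + \esum_(i in `[u, v[) (J i)%:E)%E by apply: esum_itvco_split.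
have Sfin u : u \in `[s, t] -> S u \is a fin_num.
  rewrite in_itv/= => /andP[su ut]; rewrite ge0_fin_numE//.
  apply: le_lt_trans (_ : S t < +oo)%E; last by rewrite ltey.
  by rewrite (S_split u t)// leeDl// esum_ge0// => i _; rewrite lee_fin.
have S_mono u v : u \in `[s, t] -> v \in `[s, t] -> u <= v ->
    fine (S u) <= fine (S v).
  move=> ust vst uv; rewrite fine_le ?Sfin// (S_split u v)//.
    by rewrite leeDl// esum_ge0// => i _; rewrite lee_fin.
  by move: ust; rewrite in_itv/= => /andP[].
(* The interval [[u, v[] contains its left endpoint, so the jump at [u] is among the terms gained
   from [S u] to [S v]. *)
have S_jump u v : u \in `[s, t] -> v \in `[s, t] -> u < v ->
    J u <= fine (S v) - fine (S u).
  move=> ust vst uv; rewrite lerBrDl -lee_fin EFinD !fineK ?Sfin//.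
  rewrite (S_split u v) ?(ltW uv)//; last first.
    by move: ust; rewrite in_itv/= => /andP[].
  rewrite leeD2l//; apply: (le_esum_mem (EFin \o J)); last by rewrite lee_fin.
  by rewrite /= in_itv/= lexx.
pose Phi e u := L * ((1 + e) * fine (S u) + e * g u).
have FS e : 0 < e -> {in `[s, t] &, forall u v, u <= v ->
    hausdorff_dist (F u) (F v) <= Phi e v - Phi e u}.
  move=> e0; have e1 : 0 <= 1 + e by rewrite addr_ge0 ?ltW.
  apply: (increment_bound_local_to_global
    (fun u v => hausdorff_dist (F u) (F v)) (Phi e) s t).
  - move=> x /subab xab; rewrite (le_trans (FL _ _ xab xab))//.
    by rewrite subrr normr0 powR0 ?mulr0// gt_eqF// (lt_trans ltr01).
  - move=> x y z /subab xab /subab yab /subab zab.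
    by apply: hausdorff_dist_triangle; exact: F_compact.
  - move=> x xst; have xab := subab _ (st_left _ xst).
    have /andP[sx xt] : (s <= x) && (x < t) by move: xst; rewrite in_itv.
    have [|gx Jx] := right_jump_cvg _ _ _ x g_nondecr.
      by rewrite in_itv/= (le_trans has) ?(lt_le_trans xt).
    have [delta delta0 Hdelta] := powR_le_near alpha e _ halpha e0 Jx.
    near=> y.
    have xy : x < y by near: y; exact: nbhs_right_gt.
    have yst : y \in `[s, t].
      rewrite in_itv/= (le_trans sx (ltW xy))/=.
      by near: y; exact: nbhs_right_le.
    have gxy := g_nondecr _ _ xab (subab _ yst) (ltW xy).
    have gyd : g y - g x < right_jump g x + delta.
      rewrite ltrBlDl addrA; near: y; apply: (cvgr_lt _ gx).
      by rewrite ltrDl.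
    rewrite (le_trans (FL _ _ xab (subab _ yst)))// /Phi -mulrBr ler_pM2l//.
    rewrite ger0_norm ?subr_ge0//.
    rewrite (le_trans (Hdelta _ _ gyd)) ?subr_ge0//.
    have HJ := S_jump x y (st_left _ xst) yst xy; rewrite -/(J x).
    have := ler_wpM2l e1 HJ; rewrite /Phi; lra.
  - move=> x xst; have xab := subab _ (st_right _ xst).
    have /andP[sx xt] : (s < x) && (x <= t) by move: xst; rewrite in_itv.
    have xab' : x \in `]a, b].
      by rewrite in_itv/= (le_lt_trans has sx) (le_trans xt).
    have gx := g_left_cont _ xab'.
    (* Left continuity rules out a jump from the left, hence [J = 0] here; of [S] only monotonicity
       is then used. *)
    have [delta delta0 Hdelta] := powR_le_near alpha e 0 halpha e0 (lexx _).
    near=> y.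
    have yx : y < x by near: y; exact: nbhs_left_lt.
    have yst : y \in `[s, t].
      rewrite in_itv/= (le_trans (ltW yx) xt) andbT.
      by near: y; exact: nbhs_left_ge.
    have gyx := g_nondecr _ _ (subab _ yst) xab (ltW yx).
    have gyd : g x - g y < 0 + delta.
      rewrite add0r ltrBlDr -ltrBlDl; near: y; apply: (cvgr_gt _ gx).
      by rewrite ltrBlDr ltrDl.
    rewrite (le_trans (FL _ _ (subab _ yst) xab))// /Phi -mulrBr ler_pM2l//.
    rewrite ger0_norm ?subr_ge0//.
    rewrite (le_trans (Hdelta _ _ gyd)) ?subr_ge0//.
    rewrite powR0 ?gt_eqF ?(lt_trans ltr01)// mulr0 add0r.
    have HS := S_mono y x yst (st_right _ xst) (ltW yx).
    have := ler_wpM2l e1 HS; rewrite /Phi; lra.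
have S_s : S s = 0%E by rewrite /S set_itvco0// esum_set0.
have tst : t \in `[s, t] by rewrite in_itv/= lexx ltW.
rewrite -(fineK (Sfin t tst)) -EFinM lee_fin.
apply/ler_addgt0Pr => eta eta0.
(* Since [S s = 0], [K] is the coefficient of [e] in [Phi e t - Phi e s]. *)
set K := L * (fine (S t) + (g t - g s)).
have K0 : 0 <= K.
  rewrite mulr_ge0 ?(ltW L0)// addr_ge0 ?fine_ge0// subr_ge0.
  by apply: g_nondecr (ltW hst); apply: subab => //; rewrite in_itv/= lexx ltW.
(* Dividing by [K + 1] avoids the case [K = 0] and still gives [e * K <= eta]. *)
pose e := eta / (K + 1).
have e0 : 0 < e by rewrite divr_gt0// ltr_wpDl.
have eK : e * K <= eta.
  by rewrite /e mulrAC ler_pdivrMr ?ltr_wpDl// ler_pM2l// lerDl.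
have := hausdorff_variation_le _ _ _ _ _ (FS e e0) sp.
move=> /le_trans; apply; rewrite /Phi S_s /=.
apply: le_trans (lerD (lexx _) eK); rewrite /K; lra.
Unshelve. all: by end_near. Qed.
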